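(* For every positive integer $n$, $$\operatorname{ldim}(\mathcal{M}_n) = n.$$
   Context: A poset is a pair $P=(X,\leq)$ where $X$ is a non-empty (possibly infinite) set and $\leq$ is a reflexive, antisymmetric, transitive relation on $X$. A poset $Q$ is a subposet of $P$ if the ground set of $Q$ is a subset of that of $P$ and the order of $Q$ is the restriction of the order of $P$. A linear extension of $P$ is a linear order $L$ on the ground set of $P$ such that $x\leq_L y$ whenever $x\leq_P y$. A partial linear extension of $P$ is a linear extension of a subposet of $P$. A local realizer of $P$ is a family $\mathcal{L}$ of partial linear extensions of $P$ such that for all $x,y\in P$ there exists $L\in\mathcal{L}$ with $x,y\in L$, and $x\leq_P y$ if and only if there is no $L\in\mathcal{L}$ with $y<_L x$. The frequency of an element $x\in P$ in $\mathcal{L}$ is the number of $L\in\mathcal{L}$ with $x\in L$ (i.e. $x$ is in the ground set of $L$); the frequency of $\mathcal{L}$ is the maximum frequency of an element of $P$ in $\mathcal{L}$. The local dimension $\operatorname{ldim}(P)$ is the minimum frequency of a local realizer of $P$. For a positive integer $n$, $\mathcal{M}_n$ is the poset of all multisets with elements in $[n]=\{1,\dots,n\}$ (each element has an arbitrary nonnegative integer multiplicity), ordered by multiset inclusion, i.e. $A\leq B$ if and only if for every $x\in[n]$ the multiplicity of $x$ in $A$ is at most its multiplicity in $B$. *)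

(* Defs.v *)
From HB Require Import structures.
From mathcomp Require Import all_boot all_order.
From mathcomp Require Import finmap multiset.
From mathcomp Require Import boolp classical_sets functions cardinality.

Set Implicit Arguments.
Unset Strict Implicit.
Unset Printing Implicit Defensive.

Import Order.TTheory.

Local Open Scope order_scope.
Local Open Scope classical_set_scope.
Local Open Scope card_scope.

(* The relation is required to vanish outside the ground set, so that two
   partial linear extensions are equal exactly when they have the same ground
   set and the same order on it; this matters when a family is counted.
   Reflexivity on the ground set is the case x = y of [ple_ext]. *)
Record partial_linear_extension d (T : porderType d) := PartialLinearExtension {
  ground : set T;
  ple : T -> T -> Prop;
  ground_neq0 : ground !=set0;
  ple_ground : forall x y, ple x y -> ground x /\ ground y;
  ple_anti : forall x y, ple x y -> ple y x -> x = y;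
  ple_trans : forall x y z, ple x y -> ple y z -> ple x z;
  ple_total : forall x y, ground x -> ground y -> ple x y \/ ple y x;
  ple_ext : forall x y, ground x -> ground y -> x <= y -> ple x y
}.

Section LocalDimension.
Context {d : Order.disp_t} {T : porderType d}.

Definition plt (L : partial_linear_extension T) (x y : T) : Prop :=
  ple L x y /\ x <> y.

Definition local_realizer (F : set (partial_linear_extension T)) : Prop :=
  forall x y : T,
    (exists L, [/\ F L, ground L x & ground L y]) /\
    (x <= y <-> ~ exists L, F L /\ plt L y x).

Definition containing (F : set (partial_linear_extension T)) (x : T) :
  set (partial_linear_extension T) := [set L | F L /\ ground L x].

(* "The maximum of the cardinalities of the [containing F x] is [m]"; no [m]
   satisfies this when these cardinalities are infinite or unbounded. *)
Definition has_frequency (F : set (partial_linear_extension T)) (m : nat) :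
  Prop :=
  (forall x, containing F x #<= `I_m) /\ (exists x, containing F x #= `I_m).

End LocalDimension.

(* "ldim T = m".  Local realizers without a finite frequency cannot lower the
   minimum, so it is enough to compare with those that have one. *)
Definition has_ldim d (T : porderType d) (m : nat) : Prop :=
  (exists F : set (partial_linear_extension T),
     local_realizer F /\ has_frequency F m) /\
  (forall (F : set (partial_linear_extension T)) (k : nat),
     local_realizer F -> has_frequency F k -> (m <= k)%N).

Lemma has_ldim_unique d (T : porderType d) (m k : nat) :
  has_ldim T m -> has_ldim T k -> m = k.
Proof.
move=> [[F [rF fF]] minm] [[G [rG fG]] mink]; apply/eqP.
by rewrite eqn_leq (minm _ _ rG fG) (mink _ _ rF fF).
Qed.

Fact mset_display : Order.disp_t. Proof. exact: Order.Disp tt tt. Qed.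

Lemma msubset_anti (K : choiceType) : antisymmetric (@msubset K).
Proof. by move=> A B; rewrite -eqEmsubset => /eqP. Qed.

HB.instance Definition _ (K : choiceType) := Choice.on {mset K}%mset.
HB.instance Definition _ (K : choiceType) :=
  Order.Le_isPOrder.Build mset_display {mset K}%mset
    (@msubset_refl K) (@msubset_anti K) (@msubset_trans K).

Lemma mset_leP (K : choiceType) (A B : {mset K}%mset) :
  reflect (forall x, (A x <= B x)%N) (A <= B).
Proof. exact: msubsetP. Qed.

(* The multisets over an [n]-element set; 'I_n = {0, ..., n - 1} plays the role
   of {1, ..., n}. *)
Notation calM n := {mset 'I_n}%mset.

(* Main.v *)
Require Import Defs.
From mathcomp Require Import all_boot all_order finmap multiset.
From mathcomp Require Import boolp classical_sets functions cardinality zify.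

Set Implicit Arguments.
Unset Strict Implicit.
Unset Printing Implicit Defensive.

Import Order.TTheory.

(** Upper bound: for each coordinate [i], order the multisets lexicographically
    with coordinate [i] read first ([lex_extension]).  These [n] linear
    extensions of the product order on N^n realize it, and each contains every
    multiset ([lex_realizerP], [lex_realizer_frequency]).

    Lower bound ([ldim_mset_ge]): take a local realizer of frequency at most
    [k].  Every multiset [x] lies in at most [k] of its partial linear
    extensions, so these can be labelled, separately for each [x], by numbers
    below [k].  Colour an ordered pair [(x, y)] by the set of all label pairs
    [(a, b)] such that some [L] places [x] below [y], has label [a] at [x] and
    label [b] at [y]; there are finitely many colours.  Ramsey's theorem for
    [2n]-element sets of integers yields a 3 x ... x 3 subgrid of N^n on which
    the colour of a pair that increases in coordinate [i] and decreases in all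
    others depends on [i] only ([grid_ramsey]); call it [d i].

    Each [d i] is nonempty, since the first point of such a pair is not above
    the second, so that some extension places it below.  Comparing the
    three pairs taken from a chain [x, y, z] in which all pairs have this shape
    shows that [d i] contains a diagonal pair [(a_i, a_i)]
    ([label_pairs_diag]): within direction [i], the extension with label [a_i]
    at one point is also the one with label [a_i] at the other.

    If [a_i = a_j] with [i <> j], choose grid points [u, v, w] where [u] to [v]
    increases only in coordinate [i], where [v] to [w] increases only in
    coordinate [j], and where nevertheless [w <= u].  The same extension [L]
    then witnesses both steps ([label_pairs_glue]) and places [u] strictly
    below [w], although it extends the order.  So [i |-> a_i] is an injection
    of the [n] directions into the [k] labels. *)

(** * Ramsey's theorem for increasing sequences of integers *)

Definition unbounded (A : set nat) := forall m, exists2 x, m < x & A x.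

Definition homogeneous (C : Type) (c : seq nat -> C) r (B : set nat) (d : C) :=
  forall s, sorted ltn s -> size s = r -> (forall x, x \in s -> B x) -> c s = d.

Lemma unbounded_pigeonhole (C : finType) (f : nat -> C) :
  exists d, unbounded (fun t => f t = d).
Proof.
apply: contrapT => nd.
have /choice[M Mf] : forall d, exists m, forall t, m < t -> f t <> d.
  move=> d; apply: contrapT => H; apply: nd; exists d => m.
  apply: contrapT => H'; apply: H; exists m => t mt ft.
  by apply: H'; exists t.
apply: (Mf (f (\max_d M d).+1) (\max_d M d).+1) => //.
by rewrite ltnS leq_bigmax.
Qed.

(** By induction on [r].  Peeling off elements [a t] one at a time, and each
    time shrinking the set of later elements by the case [r], makes the colour
    of an increasing sequence of [r + 1] peeled elements a function [d] of the
    index of its first element alone; the elements for which [d] takes one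
    value, attained at unboundedly many indices, form a homogeneous set. *)
Lemma ramsey (C : finType) r (c : seq nat -> C) (A : set nat) :
  unbounded A ->
  exists B d, [/\ subset B A, unbounded B & homogeneous c r B d].
Proof.
elim: r c A => [|r IHr] c A uA.
  by exists A, (c [::]); split=> // s _ /size0nil ->.
pose step (A1 A2 : set nat) := unbounded A1 -> [/\ unbounded A2, subset A2 A1 &
  exists a d, [/\ A1 a, forall x, A2 x -> a < x &
                  homogeneous (fun s => c (a :: s)) r A2 d]].
have stepP A1 : {A2 | step A1 A2}.
  apply/cid; have [uA1|nA1] := pselect (unbounded A1); last by exists A1.
  have [a _ A1a] := uA1 0.
  (* [a] is the next peeled element, [A2] the set of candidates left. *)
  have [|A2 [d [sA uA2 hA]]] :=
    IHr (fun s => c (a :: s)) (fun x => A1 x /\ a < x).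
    move=> m; have [x] := uA1 (maxn a m).
    by rewrite gtn_max => /andP[ax mx] A1x; exists x.
  exists A2 => _; split=> // [x /sA[]//|].
  by exists a, d; split=> // x /sA[].
have [G [G0 Gs]] := dependent_choice stepP A.
have uG t : unbounded (G t).
  by elim: t => [|t /Gs[]//]; rewrite G0.
have sG t t' : t <= t' -> subset (G t') (G t).
  move/subnKC <-; elim: (t' - t) => [|q IHq]; first by rewrite addn0.
  move=> x; rewrite addnS => Gx; apply: IHq.
  by have [_ + _] := Gs _ (uG (t + q)); apply.
have /choice[a /choice[d ad]] t :
    exists a d, [/\ G t a, forall x, G t.+1 x -> a < x &
                    homogeneous (fun s => c (a :: s)) r (G t.+1) d].
  by have [] := Gs t (uG t).
have lta t t' : t < t' -> a t < a t'.
  move=> tt'; have [_ + _] := ad t; apply; apply: (sG _ _ tt').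
  by have [] := ad t'.
have a_ge t : t <= a t.
  by elim: t => // t IHt; rewrite (leq_ltn_trans IHt)// lta.
have [d0 ud0] := unbounded_pigeonhole d.
exists (fun x => exists2 t, d t = d0 & x = a t), d0; split.
- by move=> x [t _ ->]; rewrite -G0; apply: (sG 0 t) => //; have [] := ad t.
- move=> m; have [t mt dt] := ud0 m; exists (a t); last by exists t.
  exact: leq_trans mt (a_ge t).
case=> // x s /= sxs [size_s] Bs.
have [t dt xt] := Bs x (mem_head _ _).
have [_ _ Hd] := ad t.
rewrite xt -dt; apply: Hd => //; first exact: path_sorted sxs.
move=> y ys; have [|t' _ yt'] := Bs y; first by rewrite inE ys orbT.
have xy : x < y by apply: (allP (order_path_min ltn_trans sxs)).
rewrite yt'; apply: (sG _ t'); last by have [] := ad t'.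
rewrite ltnNge; apply/negP; rewrite leq_eqVlt => /orP[/eqP e|/lta].
  by rewrite xt yt' e ltnn in xy.
by move=> y_x; rewrite xt yt' ltnNge (ltnW y_x) in xy.
Qed.

Lemma ramsey_sequence (C : finType) r (c : seq nat -> C) :
  exists (h : nat -> nat) (d : C), {homo h : p q / p < q} /\
    forall s, sorted ltn s -> size s = r -> c (map h s) = d.
Proof.
have [|B [d [_ uB hB]]] := @ramsey C r c (fun=> True).
  by move=> m; exists m.+1.
have /choice[next nextP] m : exists x, m < x /\ B x.
  by have [x mx Bx] := uB m; exists x.
pose h t := iter t.+1 next 0.
have lth : {homo h : p q / p < q}.
  by apply: homo_ltn => [p q s|p]; [apply: ltn_trans|case: (nextP (h p))].
exists h, d; split=> // s ss sz; apply: hB; rewrite ?size_map//.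
  by rewrite (homo_sorted (e := ltn)).
by move=> _ /mapP[t _ ->]; case: (nextP (iter t next 0)).
Qed.

(** * Homogeneous grids of multisets *)

Definition mset_fun n (f : 'I_n -> nat) : calM n :=
  [fsfun i in seq_fset tt (enum 'I_n) => f i].

Lemma mset_funE n (f : 'I_n -> nat) i : mset_fun f i = f i.
Proof. by rewrite /mset_fun fsfun_fun seq_fsetE mem_enum. Qed.

(** The [j]-th coordinate is taken from the [j]-th block of [m] consecutive
    values of [h].  For increasing [h] the blocks of distinct coordinates do not
    interleave, so that the order pattern of all coordinates of two grid points
    is determined by comparing them coordinate by coordinate. *)
Definition grid_point n m (h : nat -> nat) (u : 'I_n -> 'I_m) : calM n :=
  mset_fun (fun j => h (m * j + u j)).

Definition opposed n m (i : 'I_n) (u v : 'I_n -> 'I_m) :=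
  forall j, if j == i then u j < v j else v j < u j.

(** An increasing sequence of length [2n] encodes, for each [i], a pair of
    points opposed in direction [i]: its entries of index [2j] and [2j + 1] are the
    smaller and the larger of the two [j]-th coordinates.  Colouring the
    sequence by all [n] colours of these pairs reduces the claim to Ramsey's
    theorem. *)
Lemma grid_ramsey n m (C : finType) (c : calM n -> calM n -> C) :
  exists2 h : nat -> nat, {homo h : p q / p < q} &
  exists d : 'I_n -> C, forall i (u v : 'I_n -> 'I_m),
    opposed i u v -> c (grid_point h u) (grid_point h v) = d i.
Proof.
pose x i s : calM n := mset_fun (fun j => nth 0 s (j.*2 + (j != i))).
pose y i s : calM n := mset_fun (fun j => nth 0 s (j.*2 + (j == i))).
have [h [d [lth hd]]] :=
  ramsey_sequence n.*2 (fun s => [ffun i => c (x i s) (y i s)]).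
exists h => //; exists d => i u v uv.
have m_gt0 : 0 < m by exact: leq_ltn_trans (leq0n _) (ltn_ord (u i)).
(* The positions, among the values of [h], of the 2n coordinates of [u] and [v]
   in increasing order; the default 0 is used only for q >= 2n. *)
pose e q := m * q./2 + (if insub q./2 is Some j then
  if odd q then maxn (u j) (v j) else minn (u j) (v j) else 0).
have e_even (j : 'I_n) : e j.*2 = m * j + minn (u j) (v j).
  by rewrite /e doubleK valK odd_double.
have e_odd (j : 'I_n) : e j.*2.+1 = m * j + maxn (u j) (v j).
  by rewrite /e -[j.*2.+1]/(true + j.*2) half_bit_double valK oddD odd_double.
have lt_e : {in gtn n.*2 &, {homo e : p q / p < q}}.
  have in_e p : p < n.*2 -> exists j : 'I_n, p = j.*2 \/ p = j.*2.+1.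
    move=> pn; have jn : p./2 < n by rewrite -ltn_double; lia.
    by exists (Ordinal jn) => /=; lia.
  apply: homo_ltn_in => [p q s| |]; first exact: ltn_trans.
    by move=> p q _ + s /andP[_ sq]; rewrite !inE => qn; apply: ltn_trans qn.
  move=> p; rewrite !inE => pn p1n.
  have [j [] pj] := in_e _ pn; subst p.
    by rewrite e_even e_odd; have := uv j; case: ifP => _; lia.
  have [j' [] pj'] := in_e _ p1n; last by lia.
  have jj' : j' = j.+1 :> nat by lia.
  rewrite pj' e_even e_odd jj'.
  by have := ltn_ord (u j); have := ltn_ord (v j); lia.
have /hd : sorted ltn (mkseq e n.*2).
  rewrite (homo_sorted_in (P := gtn n.*2) (e := ltn)) ?iota_ltn_sorted//.
  by apply/allP => q; rewrite mem_iota.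
rewrite size_mkseq => /(_ erefl) /ffunP/(_ i) <-; rewrite ffunE; congr c;
  apply/msetP => j; rewrite !mset_funE.
  rewrite (nth_map 0) ?size_mkseq ?nth_mkseq; try by have := ltn_ord j; lia.
  have := uv j; case: ifP => _ ltuv; rewrite ?addn0 ?addn1 ?e_odd ?e_even.
    by rewrite (minn_idPl (ltnW ltuv)).
  by rewrite (maxn_idPl (ltnW ltuv)).
rewrite (nth_map 0) ?size_mkseq ?nth_mkseq; try by have := ltn_ord j; lia.
have := uv j; case: ifP => _ ltuv; rewrite ?addn0 ?addn1 ?e_odd ?e_even.
  by rewrite (maxn_idPr (ltnW ltuv)).
by rewrite (minn_idPr (ltnW ltuv)).
Qed.

(** * Labelling the members of a local realizer *)

Section LocalRealizer.
Context {disp : Order.disp_t} {T : porderType disp}.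
Implicit Types (F : set (partial_linear_extension T)) (x y z : T).

Lemma plt_trans (L : partial_linear_extension T) x y z :
  plt L x y -> plt L y z -> plt L x z.
Proof.
move=> [xy nxy] [yz _]; split; first exact: ple_trans xy yz.
by move=> xz; subst z; apply: nxy; apply: ple_anti xy yz.
Qed.

Lemma plt_asym (L : partial_linear_extension T) x y : plt L x y -> ~ plt L y x.
Proof. by move=> [xy nxy] [yx _]; apply/nxy/(ple_anti xy yx). Qed.

Lemma ge_not_plt (L : partial_linear_extension T) x y :
  (y <= x)%O -> ~ plt L x y.
Proof.
move=> yx [xy nxy]; apply: nxy; have [Lx Ly] := ple_ground xy.
exact: (ple_anti xy (ple_ext Ly Lx yx)).
Qed.

Lemma local_realizer_plt F x y : local_realizer F -> ~~ (y <= x)%O ->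
  exists2 L, F L & plt L x y.
Proof.
move=> rF yx; apply: contrapT => H; move/negP: yx; apply.
by have [_ [_]] := rF y x; apply=> -[L [FL xy]]; apply: H; exists L.
Qed.

(** The labels of two extensions are compared at one point only: the label of an
    extension may vary from point to point. *)
Definition labelling F k (g : T -> partial_linear_extension T -> 'I_k) :=
  forall x L L', containing F x L -> containing F x L' -> g x L = g x L' ->
    L = L'.

Lemma labelling_exists F k : local_realizer F ->
  (forall x, containing F x #<= `I_k)%card ->
  exists g : T -> partial_linear_extension T -> 'I_k, labelling F g.
Proof.
move=> rF Fk.
suff /choice[g gP] : forall x, exists g : partial_linear_extension T -> 'I_k,
    forall L L', containing F x L -> containing F x L' -> g L = g L' -> L = L'.
  by exists g.
move=> x; have /pcard_leP[f] := Fk x.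
have [[L0 [FL0 xL0 _]] _] := rF x x.
have fk L : containing F x L -> f L < k.
  by move=> xL; exact: (funS (s := f) L xL).
(* Some [L0] contains [x], so [k] is positive and a default label exists. *)
exists (fun L => insubd (Ordinal (fk L0 (conj FL0 xL0))) (f L)) => L L' xL xL'.
by move/(congr1 val); rewrite !val_insubd !fk//; apply: inj; rewrite inE.
Qed.

Definition label_pairs F k (g : T -> partial_linear_extension T -> 'I_k) x y :
    {set 'I_k * 'I_k} :=
  [set p | `[< exists L, [/\ F L, plt L x y, g x L = p.1 & g y L = p.2] >]].

Lemma label_pairsP F k (g : T -> partial_linear_extension T -> 'I_k) x y a b :
  reflect (exists L, [/\ F L, plt L x y, g x L = a & g y L = b])
    ((a, b) \in label_pairs F g x y).
Proof. by rewrite inE; apply: asboolP. Qed.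

(** The label [b] at the middle point [y] forces both pairs to be witnessed by
    the same extension. *)
Lemma label_pairs_glue F k (g : T -> partial_linear_extension T -> 'I_k)
    x y z a b c : labelling F g ->
  (a, b) \in label_pairs F g x y -> (b, c) \in label_pairs F g y z ->
  exists L, plt L x z.
Proof.
move=> gF /label_pairsP[L [FL xy _ yb]] /label_pairsP[M [FM yz yb' _]].
have [_ Ly] := ple_ground xy.1; have [My _] := ple_ground yz.1.
have LM : L = M by apply: (gF y); rewrite ?yb.
by exists M; apply: plt_trans yz; rewrite -LM.
Qed.

(** The witnesses for [(x, y)] and [(x, z)] share the label [a] at [x], and
    those for [(x, z)] and [(y, z)] share the label [b] at [z]; so all three are the
    same extension, whose label at [y] is both [a] and [b]. *)
Lemma label_pairs_diag F k (g : T -> partial_linear_extension T -> 'I_k)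
    x y z a b : labelling F g ->
  (a, b) \in label_pairs F g x y -> (a, b) \in label_pairs F g x z ->
  (a, b) \in label_pairs F g y z -> a = b.
Proof.
move=> gF /label_pairsP[L [FL xy xa yb]] /label_pairsP[M [FM xz xa' zb]].
move=> /label_pairsP[N [FN yz ya zb']].
have [Lx Ly] := ple_ground xy.1; have [Mx Mz] := ple_ground xz.1.
have [Ny Nz] := ple_ground yz.1.
have LM : L = M by apply: (gF x); rewrite ?xa.
have NM : N = M by apply: (gF z); rewrite ?zb.
by rewrite -ya -yb LM NM.
Qed.

End LocalRealizer.

(** * The lower bound *)

(** A grid with three values per coordinate is large enough for both the chain
    to which [label_pairs_diag] applies and the two-step path that returns below
    its start. *)
Lemma ldim_mset_ge n F k : local_realizer F ->
  (forall x : calM n, containing F x #<= `I_k)%card -> n <= k.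
Proof.
move=> rF Fk; have [g gF] := labelling_exists rF Fk.
have [h lth [d hd]] := @grid_ramsey n 3 _ (label_pairs F g).
pose chain i t (j : 'I_n) : 'I_3 := inord (if j == i then t else 2 - t).
have chainP i s t : s < t -> t < 3 -> opposed i (chain i s) (chain i t).
  by move=> st t3 j; rewrite /chain; case: (j == i); rewrite !inordK; lia.
have diag i : exists a, (a, a) \in d i.
  pose p t : calM n := grid_point h (chain i t).
  have pd s t : s < t -> t < 3 -> label_pairs F g (p s) (p t) = d i.
    by move=> st t3; apply/hd/chainP.
  have /(local_realizer_plt rF)[L FL L01] : ~~ (p 1 <= p 0)%O.
    apply/negP => /mset_leP/(_ i); rewrite !mset_funE leqNgt lth // ltn_add2l.
    by rewrite /chain eqxx !inordK; lia.
  have Ld : (g (p 0) L, g (p 1) L) \in d i.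
    by rewrite -(pd 0 1)//; apply/label_pairsP; exists L.
  have ab : g (p 0) L = g (p 1) L.
    by apply: (@label_pairs_diag _ _ F k g (p 0) (p 1) (p 2)); rewrite // pd.
  by exists (g (p 0) L); rewrite {2}ab.
have /choice[a ad] := diag.
suff inj_a : injective a by have := leq_card a inj_a; rewrite !card_ord.
move=> i j aij; apply: contrapT => /eqP nij.
(* Coordinate i runs through 1, 2, 0, coordinate j through 2, 0, 1 and all the
   others through 2, 1, 0; hence w <= u. *)
pose u l : 'I_3 := if l == i then inord 1 else inord 2.
pose v l : 'I_3 :=
  if l == i then inord 2 else if l == j then inord 0 else inord 1.
pose w l : 'I_3 := if l == j then inord 1 else inord 0.
have uv : opposed i u v.
  by move=> l; rewrite /u /v; case: (l == i); case: (l == j); rewrite !inordK.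
have vw : opposed j v w.
  move=> l; rewrite /w /v; case: (eqVneq l j) => [->|_].
    by rewrite (eq_sym j i) (negbTE nij) !inordK.
  by case: (l == i); rewrite !inordK.
have [L Luw] : exists L, plt L (grid_point h u) (grid_point h w).
  apply: (@label_pairs_glue _ _ F k g _ (grid_point h v) _ (a i) (a i) (a i));
    first exact: gF.
    by rewrite (hd i).
  by rewrite (hd j) // aij.
apply: ge_not_plt Luw; apply/mset_leP => l; rewrite !mset_funE.
have : w l <= u l.
  by rewrite /u /w; case: (l == i); case: (l == j); rewrite !inordK.
rewrite leq_eqVlt => /orP[/eqP->//|wu].
by apply/ltnW/lth; rewrite ltn_add2l.
Qed.

(** * The upper bound *)

(** Keeping the whole list of multiplicities after the leading one makes the
    key injective without rotating the coordinates. *)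
Definition lex_key n q (x : calM n) : seqlexi nat :=
  let s := [seq x j | j <- enum 'I_n] in nth 0 s q :: s.

Lemma lex_key_inj n q : injective (@lex_key n q).
Proof.
move=> x y [_ /eq_in_map xy]; apply/msetP => j; apply: xy.
by rewrite mem_enum.
Qed.

Lemma lex_key_le n q (x y : calM n) :
  (x <= y)%O -> (lex_key q x <= lex_key q y)%O.
Proof.
move=> /mset_leP xy; suff : (lex_key q x <= lex_key q y :> seqprod nat)%O.
  exact: sub_seqprod_lexi.
have le_map (s : seq 'I_n) :
    ([seq x j | j <- s] <= [seq y j | j <- s] :> seqprod nat)%O.
  by elim: s => //= j s IHs; rewrite Order.SeqProdOrder.le_cons leEnat xy.
rewrite /lex_key Order.SeqProdOrder.le_cons le_map andbT leEnat.
by elim: (enum _) q => [|j s IHs] [|q] //=.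
Qed.

Lemma lex_key_lt n (i : 'I_n) (x y : calM n) : x i < y i ->
  (lex_key i x < lex_key i y)%O.
Proof.
have nth_enum (z : calM n) : nth 0 [seq z j | j <- enum 'I_n] i = z i.
  by rewrite (nth_map i) ?nth_ord_enum // size_enum_ord.
by move=> xy; rewrite /lex_key ltxi_cons !nth_enum !leEnat (ltnW xy) leqNgt xy.
Qed.

Definition lex_le n q (x y : calM n) : Prop := (lex_key q x <= lex_key q y)%O.

Lemma lex_le_anti n q (x y : calM n) : lex_le q x y -> lex_le q y x -> x = y.
Proof. by move=> xy yx; apply/(@lex_key_inj n q)/le_anti/andP. Qed.

Lemma lex_le_trans n q (x y z : calM n) :
  lex_le q x y -> lex_le q y z -> lex_le q x z.
Proof. exact: le_trans. Qed.

Lemma lex_le_total n q (x y : calM n) : lex_le q x y \/ lex_le q y x.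
Proof. exact/orP/le_total. Qed.

Definition lex_extension n q : partial_linear_extension (calM n) :=
  @PartialLinearExtension _ (calM n) setT (@lex_le n q)
    (ex_intro _ mset0 I) (fun _ _ _ => conj I I)
    (@lex_le_anti n q) (@lex_le_trans n q)
    (fun x y _ _ => lex_le_total q x y) (fun x y _ _ => @lex_key_le n q x y).

Lemma plt_lex n (i : 'I_n) (x y : calM n) : x i < y i ->
  plt (lex_extension n i) x y.
Proof.
move=> xy; split; first exact/ltW/lex_key_lt.
by move=> e; rewrite e ltnn in xy.
Qed.

Definition lex_realizer n : set (partial_linear_extension (calM n)) :=
  image `I_n (lex_extension n).

Arguments lex_realizer : clear implicits.

Lemma lex_realizerP n : 0 < n -> local_realizer (lex_realizer n).
Proof.
move=> n_gt0 x y; split.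
  by exists (lex_extension n 0); split=> //; exists 0.
split=> [xy [L [_ /ge_not_plt]]|H]; first exact.
apply/mset_leP => i; rewrite leqNgt; apply/negP => yx; apply: H.
by exists (lex_extension n i); split; [exists (val i) => /=|exact: plt_lex].
Qed.

(** The [n] lexicographic orders are pairwise distinct: those led by [i] and by
    [j] order the singletons of [i] and [j] in opposite ways. *)
Lemma lex_realizer_frequency n x :
  (containing (lex_realizer n) x #= `I_n)%card.
Proof.
have -> : containing (lex_realizer n) x = lex_realizer n.
  by apply/seteqP; split=> [L []//|L FL]; split=> //; case: FL => q _ <-.
apply: inj_card_eq => p q; rewrite !inE /= => pn qn pq.
apply: contrapT => /eqP npq.
pose i := Ordinal pn; pose j := Ordinal qn.
apply: (@plt_asym _ _ (lex_extension n p) [mset i]%mset [mset j]%mset).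
  rewrite pq; apply: (@plt_lex _ j).
  by rewrite !msetnE eqxx -val_eqE /= eq_sym (negbTE npq).
by apply: (@plt_lex _ i); rewrite !msetnE eqxx -val_eqE /= (negbTE npq).
Qed.

Theorem theorem5 (n : nat) (n_gt0 : (0 < n)%N) : has_ldim (calM n) n.
Proof.
split=> [|F k rF [Fk _]]; last exact: ldim_mset_ge rF Fk.
exists (lex_realizer n); split; first exact: lex_realizerP.
split=> [x|]; last by exists mset0; apply: lex_realizer_frequency.
by have [] := (card_eqPle _ _).1 (lex_realizer_frequency x).
Qed.
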